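(* Let $n\ge 3$ and set $\gamma_3=1$, $\gamma_4=2$, $\gamma_5=\sqrt 5$, and $\gamma_n=2.25$ for $n\ge 6$. Suppose $\rho,\lambda_2,\lambda_3,\ldots,\lambda_n$ are the eigenvalues (counted with algebraic multiplicity) of an $n\times n$ nonnegative matrix $A$ such that $\rho$ is the Perron eigenvalue of $A$, and $\lambda_2=b+ic$, $\lambda_3=b-ic$ (with $b,c\in\mathbb{R}$, $c\ne 0$) is a non-real complex conjugate pair. Then for any $t\in[0,\infty)$ and any real $\tilde t\ge \gamma_n t$, there is an $n\times n$ nonnegative matrix with eigenvalues (counted with algebraic multiplicity) $$\rho+\tilde t,\ \lambda_2+t,\ \lambda_3+t,\ \lambda_4,\ldots,\lambda_n.$$
   Context: A matrix is called nonnegative if it is a real matrix all of whose entries are $\ge 0$. The Perron eigenvalue of a nonnegative square matrix is its spectral radius, which is an eigenvalue of the matrix. *)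

(* Defs.v *)
From mathcomp Require Import all_boot all_order all_algebra.
From mathcomp Require Import all_classical all_reals.
From mathcomp Require Import complex.
Set Implicit Arguments.
Unset Strict Implicit.
Unset Printing Implicit Defensive.
Import Order.TTheory GRing.Theory Num.Theory.
Local Open Scope ring_scope.
Local Open Scope complex_scope.
Local Open Scope classical_set_scope.

Definition nonnegative_mx (R : realType) (n : nat) (A : 'M[R]_n) : Prop :=
  forall i j, 0 <= A i j.

Definition complexify (R : realType) (n : nat) (A : 'M[R]_n) : 'M[R[i]]_n :=
  map_mx (real_complex R) A.

(* The order of [s] is irrelevant; algebraic multiplicities are recorded by
   repetition, and the equality forces [size s = n]. *)
Definition has_eigenvalues (R : realType) (n : nat) (A : 'M[R]_n)
    (s : seq R[i]) : Prop :=
  char_poly (complexify A) = \prod_(z <- s) ('X - z%:P).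

(* The norm of [R[i]] is itself valued in [R[i]], hence the real part. *)
Definition spectral_radius (R : realType) (n : nat) (A : 'M[R]_n) : R :=
  sup [set complex.Re `|z| | z in [set z | eigenvalue (complexify A) z]].

Definition perron_eigenvalue (R : realType) (n : nat) (A : 'M[R]_n) : R :=
  spectral_radius A.

(* Only meaningful for [3 <= n]. *)
Definition gamma (R : realType) (n : nat) : R :=
  match n with
  | 3%N => 1
  | 4%N => 2
  | 5%N => Num.sqrt 5
  | _ => 9 / 4
  end.

(* Main.v *)
Require Import Defs.
From mathcomp Require Import all_boot all_order all_fingroup all_algebra.
From mathcomp Require Import all_classical all_reals.
From mathcomp Require Import polyrcf complex.
From mathcomp Require Import ring lra.
Set Implicit Arguments.
Unset Strict Implicit.
Unset Printing Implicit Defensive.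
Import Order.TTheory GRing.Theory Num.Theory.
Local Open Scope ring_scope.
Local Open Scope complex_scope.

(** Replacing [A] by another nonnegative matrix with the same characteristic
    polynomial, all row sums may be assumed equal to [rho]
    ([row_sum_realization]): a positive Perron vector is turned into the
    all-ones vector by a diagonal similarity, and in the reducible case the
    off-diagonal block of a block triangular form, on which the characteristic
    polynomial does not depend, is used to raise the remaining row sums.

    Write [u + iv] for an eigenvector of [b + ic].  The rows of the [n x 3]
    matrix [[1 | u | v]] are [n] points of an affine plane, and they are not
    collinear.  Among the triangles with vertices in this finite set let
    [f 0, f 1, f 2] be one of maximal area, and let [Y] be the [n x 3] matrix
    of barycentric coordinates of the points with respect to it.  The columns
    of [Y] span the same [A]-invariant space as [1, u, v], and the rows of
    [Y] indexed by [f] form the identity matrix.  Let [- x_k] be the minimum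
    of column [k].  Geometrically, the triangle with sides [Y_k = - x_k]
    contains all the points and is homothetic to the inscribed triangle [f],
    with ratio [1 + x_0 + x_1 + x_2].

    Adding [t (Y i k + x_k)], a nonnegative number, to the entry [(i, f k)]
    of [A] for all [i] and [k] adds [t] to the eigenvalues [b + ic] and
    [b - ic], fixes all the others but [rho], and adds
    [(1 + x_0 + x_1 + x_2) t] to [rho].  This is Rado's perturbation theorem
    ([char_poly_rado]) applied to the invariant spaces spanned by [Y] and by
    the all-ones vector.  Whatever is missing to reach [rho + t'] is added to
    a single column.  So all that is needed is
    [1 + x_0 + x_1 + x_2 <= gamma n] ([triangle_ratio]), which is a statement
    of plane geometry.

    If [x_k > 0], then the point where the minimum of column [k] is attained
    is not a vertex of the maximal triangle, and for distinct such [k] these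
    points are distinct.  Hence at most [n - 3] of the [x_k] are positive.
    One positive [x_k] is at most [1]; two of them satisfy
    [x (1 + y) <= 1] and [y (1 + x) <= 1], whence [x + y <= sqrt 5 - 1]
    ([pair_le]), with equality for the regular pentagon_le; and three of them add
    up to at most [5 / 4] ([hexagon_le]).  The only geometric input is that no
    triangle spanned by the three vertices and the (at most three) extreme
    points has a larger area than the triangle [f]. *)

(** * Characteristic polynomials *)

(** Both sides are the determinant of [block_mx M Y C 1] times [\det D]:
    column operations clear either [C] or, because [M *m Y = Y *m D], the
    block [Y]. *)
Lemma det_rado (R : comNzRingType) (n r : nat) (M : 'M[R]_n) (Y : 'M[R]_(n, r))
    (C : 'M[R]_(r, n)) (D : 'M[R]_r) :
  M *m Y = Y *m D ->
  \det (M - Y *m C) * \det D = \det M * \det (D - C *m Y).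
Proof.
move=> MY.
pose N : 'M_(n + r) := block_mx M Y C 1%:M.
(* both products are block triangular *)
have e1 : N *m block_mx 1%:M (- Y) 0 D = block_mx M 0 C (D - C *m Y).
  rewrite mulmx_block !mulmx0 !mulmx1 !addr0 mul1mx !mulmxN MY addNr.
  by rewrite [- _ + D]addrC.
have e2 : N *m block_mx 1%:M 0 (- C) 1%:M = block_mx (M - Y *m C) Y 0 1%:M.
  by rewrite mulmx_block !mulmx0 !mulmx1 !add0r mul1mx mulmxN subrr.
have := congr1 determinant e2; have := congr1 determinant e1.
rewrite !det_mulmx det_ublock det_lblock det_lblock det_ublock !det1 !mulr1 !mul1r.
by move=> e3 <-.
Qed.

(** Rado's theorem in a form free of any rank assumption on [Y]: the
    eigenvalues carried by the invariant space spanned by [Y] are replaced by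
    those of [W + C *m Y], and the others stay. *)
Lemma char_poly_rado (R : comNzRingType) (n r : nat) (A : 'M[R]_n)
    (Y : 'M[R]_(n, r)) (C : 'M[R]_(r, n)) (W : 'M[R]_r) :
  A *m Y = Y *m W ->
  char_poly (A + Y *m C) * char_poly W = char_poly A * char_poly (W + C *m Y).
Proof.
move=> AY; rewrite /char_poly /char_poly_mx !map_mxD !map_mxM !opprD !addrA.
apply: det_rado.
by rewrite mulmxBl mulmxBr -!map_mxM AY scalar_mxC.
Qed.

Lemma char_poly_intertwine (F : fieldType) (n : nat) (A W Y : 'M[F]_n) :
  \det Y != 0 -> A *m Y = Y *m W -> char_poly A = char_poly W.
Proof.
move=> Y0 AY.
have : char_poly_mx A *m map_mx polyC Y = map_mx polyC Y *m char_poly_mx W.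
  by rewrite mulmxBl mulmxBr -!map_mxM AY scalar_mxC.
move/(congr1 determinant); rewrite !det_mulmx mulrC; apply: mulfI.
by rewrite det_map_mx polyC_eq0.
Qed.

Lemma horner_char_poly (R : comNzRingType) (n : nat) (A : 'M[R]_n) (r : R) :
  (char_poly A).[r] = \det (r%:M - A).
Proof.
rewrite -horner_evalE -det_map_mx; congr (\det _).
apply/matrixP=> i j.
by rewrite !mxE /= horner_evalE hornerD hornerN hornerMn hornerX hornerC.
Qed.

(** Brauer's theorem, the case of Rado's theorem where the invariant
    space is spanned by the all-ones vector. *)
Lemma char_poly_rank1 (R : fieldType) (n : nat) (B : 'M[R]_n) (k : 'rV[R]_n) (r : R) :
  (forall i, \sum_j B i j = r) ->
  char_poly (B + const_mx 1 *m k) * ('X - r%:P) =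
  char_poly B * ('X - (r + \sum_j k 0 j)%:P).
Proof.
move=> Br.
have cp1 (a : R) : char_poly (a%:M : 'M_1) = 'X - a%:P.
  by rewrite /char_poly det_mx11 !mxE /= !mulr1n.
have Be : B *m const_mx 1 = const_mx 1 *m (r%:M : 'M_1).
  apply/matrixP=> i j; rewrite !mxE big_ord1 !mxE ord1 mulr1n mul1r -(Br i).
  by apply: eq_bigr => l _; rewrite mxE mulr1.
have := char_poly_rado k Be; rewrite !cp1 => ->; congr (_ * _).
rewrite (_ : _ + _ = (r + \sum_j k 0 j)%:M) ?cp1 //.
apply/matrixP=> i j; rewrite !ord1 !mxE !mulr1n; congr (_ + _).
by apply: eq_bigr => l _; rewrite mxE mulr1.
Qed.

Lemma char_poly_reindex (F : fieldType) (m n : nat) (h : 'I_m -> 'I_n)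
    (A : 'M[F]_n) :
  bijective h -> char_poly (mxsub h h A) = char_poly A.
Proof.
move=> hbij; have := bij_eq_card hbij; rewrite !card_ord => mn; subst n.
pose s := perm (bij_inj hbij).
apply/esym/(@char_poly_intertwine _ _ _ _ (perm_mx s^-1)).
  by rewrite det_perm signr_eq0.
have -> : mxsub h h A = perm_mx s *m (A *m perm_mx s^-1).
  rewrite -col_permE -row_permE; apply/matrixP=> i j.
  by rewrite !mxE !permE.
by rewrite mulmxA -perm_mxM mulVg perm_mx1 mul1mx.
Qed.

Lemma char_poly_mx_block (R : nzRingType) (p q : nat)
    (Aul : 'M[R]_p) Aur Adl (Adr : 'M[R]_q) :
  char_poly_mx (block_mx Aul Aur Adl Adr) =
  block_mx (char_poly_mx Aul) (- map_mx polyC Aur)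
           (- map_mx polyC Adl) (char_poly_mx Adr).
Proof.
by rewrite /char_poly_mx map_block_mx scalar_mx_block opp_block_mx add_block_mx !add0r.
Qed.

Lemma char_poly_lblock (R : comNzRingType) (p q : nat)
    (Aul : 'M[R]_p) Adl (Adr : 'M[R]_q) :
  char_poly (block_mx Aul 0 Adl Adr) = char_poly Aul * char_poly Adr.
Proof. by rewrite /char_poly char_poly_mx_block map_mx0 oppr0 det_lblock. Qed.

Lemma char_poly_ublock (R : comNzRingType) (p q : nat)
    (Aul : 'M[R]_p) Aur (Adr : 'M[R]_q) :
  char_poly (block_mx Aul Aur 0 Adr) = char_poly Aul * char_poly Adr.
Proof. by rewrite /char_poly char_poly_mx_block map_mx0 oppr0 det_ublock. Qed.

Lemma char_poly_scaling (F : fieldType) (n : nat) (A : 'M[F]_n) (x : 'cV[F]_n) :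
  (forall i, x i 0 != 0) ->
  char_poly (\matrix_(i, j) (A i j * x j 0 / x i 0)) = char_poly A.
Proof.
move=> x0; apply/esym/(@char_poly_intertwine _ _ _ _ (diag_mx x^T)).
  by rewrite det_diag; apply/prodf_neq0 => i _; rewrite mxE.
rewrite mul_mx_diag mul_diag_mx; apply/matrixP=> i j; rewrite !mxE.
by rewrite mulrC [RHS]mulrC divfK // mulrC.
Qed.

Lemma scaling_row_sum (F : fieldType) (n : nat) (A : 'M[F]_n) (x : 'cV[F]_n) i :
  \sum_j (\matrix_(i, j) (A i j * x j 0 / x i 0)) i j = (A *m x) i 0 / x i 0.
Proof. by rewrite mxE mulr_suml; apply: eq_bigr => j _; rewrite mxE. Qed.

(** * Nonnegative matrices and Perron vectors *)

(** Polynomial continuity replaces limits of vectors and matrices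
    throughout the proof of the Perron theorem. *)
Lemma horner_ge0_right (R : rcfType) (p : {poly R}) (a : R) :
  (forall r, a < r -> 0 <= p.[r]) -> 0 <= p.[a].
Proof.
move=> pos; rewrite leNgt; apply/negP => pa.
have e0 : 0 < - p.[a] by lra.
have [d d0 /(_ (a + d / 2))] := poly_cont a p e0.
have -> : a + d / 2 - a = d / 2 by lra.
rewrite gtr0_norm; last by lra.
have lt_d : d / 2 < d by lra.
move=> /(_ lt_d); rewrite ltr_norml => /andP[_].
have lt_a : a < a + d / 2 by lra.
by have := pos _ lt_a; lra.
Qed.

Section MMatrix.
Variable R : realFieldType.
Variables (n : nat) (A : 'M[R]_n).
Hypothesis A_ge0 : forall i j, 0 <= A i j.

(** A positive vector with [A x < r x] certifies that [r] exceeds the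
    Perron eigenvalue of the nonnegative matrix [A]. *)
Definition supersolution (r : R) (x : 'cV[R]_n) : Prop :=
  forall i, 0 < x i 0 /\ (A *m x) i 0 < r * x i 0.

Lemma supersolution_le r s x :
  r <= s -> supersolution r x -> supersolution s x.
Proof.
move=> rs Hx i; have [x0 Ax] := Hx i; split=> //.
by apply: lt_le_trans Ax _; rewrite ler_pM2r.
Qed.

Lemma mulmx_ge0 (x : 'cV[R]_n) :
  (forall i, 0 <= x i 0) -> forall i, 0 <= (A *m x) i 0.
Proof. by move=> x0 i; rewrite mxE sumr_ge0 // => j _; rewrite mulr_ge0. Qed.

(** The inverse of the M-matrix [r - A] is nonnegative: at an index
    minimizing [y i / x i], a negative ratio would contradict the hypothesis
    on [y]. *)
Lemma supersolution_inv_ge0 r x (y : 'cV[R]_n) :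
  supersolution r x -> (forall i, (A *m y) i 0 <= r * y i 0) ->
  forall i, 0 <= y i 0.
Proof.
move=> Hx Hy i0.
have [i _ imin] := @arg_minP _ _ _ i0 xpredT (fun j => y j 0 / x j 0) isT.
set m := y i 0 / x i 0 in imin.
have x0 j : 0 < x j 0 by case: (Hx j).
have ym j : m * x j 0 <= y j 0 by rewrite -ler_pdivlMr // imin.
have [m0|m0] := lerP 0 m.
  by apply: le_trans (ym i0); rewrite mulr_ge0 // ltW.
exfalso; have := Hy i; rewrite leNgt => /negP; apply.
have -> : y i 0 = m * x i 0 by rewrite /m divfK // gt_eqF.
rewrite mulrCA; apply: (@lt_le_trans _ _ (m * (A *m x) i 0)).
  by rewrite ltr_nM2l //; case: (Hx i).
rewrite !mxE mulr_sumr; apply: ler_sum => j _.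
by rewrite mulrCA ler_wpM2l.
Qed.

Lemma supersolution_not_root r x : supersolution r x -> ~~ root (char_poly A) r.
Proof.
move=> Hx; rewrite rootE horner_char_poly -det_tr; apply/negP=> /det0P[v v0].
move/(congr1 trmx); rewrite trmx_mul trmxK trmx0 mulmxBl mul_scalar_mx => /eqP.
rewrite subr_eq0 => /eqP e; case/negP: v0; apply/eqP.
have e1 i : (A *m v^T) i 0 = r * v^T i 0 by rewrite -e !mxE.
have p1 : forall i, 0 <= v^T i 0.
  by apply: (supersolution_inv_ge0 Hx) => i; rewrite e1.
have p2 : forall i, 0 <= (- v^T) i 0.
  apply: (supersolution_inv_ge0 Hx) => i.
  by rewrite mulmxN [leLHS]mxE e1 [in leRHS]mxE mulrN.
apply/matrixP=> i j; rewrite ord1.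
have := p1 j; have := p2 j; rewrite !mxE; lra.
Qed.

Lemma supersolution_of_strict r (y : 'cV[R]_n) :
  (forall i, 0 <= y i 0) -> (forall i, (A *m y) i 0 < r * y i 0) ->
  supersolution r y.
Proof.
move=> y0 Hy i; split=> //; rewrite lt_neqAle y0 andbT eq_sym; apply/eqP => yi.
by have := Hy i; rewrite yi mulr0 ltNge mulmx_ge0.
Qed.

Lemma supersolution_open r x : (0 < n)%N ->
  supersolution r x -> exists2 s, s < r & supersolution s x.
Proof.
move=> n0 Hx.
have [i _ imin] := @arg_minP _ _ _ (Ordinal n0) xpredT
  (fun j => r - (A *m x) j 0 / x j 0) isT.
set d := r - _ in imin.
have x0 j : 0 < x j 0 by case: (Hx j).
have d0 : 0 < d.
  by rewrite subr_gt0 ltr_pdivrMr //; case: (Hx i).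
exists (r - d / 2); first by lra.
move=> j; split=> //; rewrite -ltr_pdivrMr //.
have := imin j isT; lra.
Qed.

Lemma supersolution_large : exists r x, supersolution r x.
Proof.
exists (1 + \sum_i \sum_j A i j), (const_mx 1) => i; rewrite !mxE; split=> //.
rewrite mulr1 (eq_bigr (A i)); last by move=> j _; rewrite mxE mulr1.
rewrite ltr_pwDl // [leRHS](bigD1 i) //= lerDl.
by rewrite sumr_ge0 // => k _; rewrite sumr_ge0.
Qed.

Lemma supersolution_gt0 r x : (0 < n)%N -> supersolution r x -> 0 < r.
Proof.
move=> n0 Hx; have [x0 Ax] := Hx (Ordinal n0).
rewrite -(pmulr_lgt0 _ x0); apply: le_lt_trans Ax.
by apply: mulmx_ge0 => i; case: (Hx i) => /ltW.
Qed.

(** The solution [y] of [(X - A) y = 1], cleared of its denominator by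
    the square of the characteristic polynomial: an even power keeps the
    sign of [y]. *)
Definition resolvent : 'cV[{poly R}]_n :=
  char_poly A *: (\adj (char_poly_mx A) *m const_mx 1).

Lemma resolventE : char_poly_mx A *m resolvent = const_mx (char_poly A ^+ 2).
Proof.
rewrite /resolvent -scalemxAr mulmxA mul_mx_adj mul_scalar_mx scalerA.
by apply/matrixP=> i j; rewrite !mxE mulr1.
Qed.

Lemma horner_char_poly_mx (W : 'cV[{poly R}]_n) (r : R) (i : 'I_n) :
  ((char_poly_mx A *m W) i 0).[r] =
  r * (W i 0).[r] - (A *m map_mx (horner_eval r) W) i 0.
Proof.
rewrite mulmxBl mul_scalar_mx !mxE hornerD hornerM hornerX hornerN horner_sum.
by congr (_ - _); apply: eq_bigr => j _; rewrite !mxE hornerM hornerC.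
Qed.

Lemma resolvent_ge0 r x : supersolution r x -> forall i, 0 <= (resolvent i 0).[r].
Proof.
move=> Hx i.
have := @supersolution_inv_ge0 r x (map_mx (horner_eval r) resolvent) Hx _ i.
rewrite mxE; apply => j.
rewrite [X in r * X]mxE -subr_ge0 -horner_char_poly_mx resolventE mxE horner_exp.
exact: sqr_ge0.
Qed.

End MMatrix.

Section Perron.
Variables (R : realType) (n : nat) (A : 'M[R]_n).
Hypothesis A_ge0 : forall i j, 0 <= A i j.

(** The numbers [r] with such an [x] form an up-closed set, bounded below
    and without a least element.  At its infimum the resolvent is still
    nonnegative by continuity; were the infimum not an eigenvalue, the
    resolvent would certify it.  So the infimum is an eigenvalue and lies
    below [rho]. *)
Lemma supersolution_exists (rho : R) :
  (forall r, rho <= r -> ~~ root (char_poly A) r) ->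
  exists x, supersolution A rho x.
Proof.
move=> noroot; have [n0|] := posnP n; last move=> n0.
  by exists 0 => -[i i_lt]; exfalso; rewrite n0 in i_lt.
pose G : set R := [set r | exists x, supersolution A r x]%classic.
have [r1 Gr1] : exists r, G r.
  by have [r [x Hx]] := supersolution_large A_ge0; exists r, x.
have lbG : has_lbound G.
  by exists 0 => r [x Hx]; apply/ltW/(supersolution_gt0 A_ge0 n0 Hx).
have above r : inf G < r -> G r.
  move=> /inf_lt[|s [x Hx] sr]; first by exists r1.
  by exists x; apply: supersolution_le Hx; apply: ltW.
have [/above//|le_rho] := ltrP (inf G) rho.
suff [x Hx] : G (inf G).
  (* contradiction: the set G contains a number below its infimum *)
  have [s s_lt Hs] := supersolution_open n0 Hx.
  have : inf G <= s by apply: ge_inf => //; exists x.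
  by rewrite leNgt s_lt.
exists (map_mx (horner_eval (inf G)) (resolvent A)).
apply: supersolution_of_strict => // i.
  rewrite mxE; apply: horner_ge0_right => r /above[x Hx].
  exact: resolvent_ge0 Hx i.
rewrite -subr_gt0 [X in _ * X]mxE -horner_char_poly_mx resolventE mxE horner_exp.
by rewrite exprn_even_gt0 //=; apply: noroot.
Qed.

(** The resolvent is nonnegative to the right of [rho].  After division
    by the largest possible power of [X - rho] it has a nonzero nonnegative
    value at [rho], and that value is an eigenvector. *)
Lemma perron_vector (rho : R) :
  root (char_poly A) rho -> (forall r, root (char_poly A) r -> r <= rho) ->
  exists x : 'cV[R]_n, [/\ forall i, 0 <= x i 0, x != 0 & A *m x = rho *: x].
Proof.
move=> rt rt_max.
have above r : rho < r -> exists x, supersolution A r x.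
  move=> lt_r; apply: supersolution_exists => s le_s; apply/negP=> /rt_max.
  by rewrite leNgt (lt_le_trans lt_r).
pose V := resolvent A.
have [i0 V0] : exists i, V i 0 != 0.
  have n0 : (0 < n)%N.
    have := root_size_gt1 (monic_neq0 (char_poly_monic A)) rt.
    by rewrite size_char_poly ltnS.
  have [/existsP//|/existsPn V0] := boolP [exists i, V i 0 != 0].
  exfalso.
  have := congr1 (fun M : 'cV_n => M (Ordinal n0) 0) (resolventE A).
  have -> : resolvent A = 0.
    apply/matrixP=> i j; rewrite ord1 [RHS]mxE.
    by have := V0 i; rewrite negbK => /eqP; exact.
  rewrite mulmx0 !mxE => /eqP; rewrite eq_sym expf_eq0 /=.
  by rewrite (negPf (monic_neq0 (char_poly_monic A))).
pose P k := [forall i, ('X - rho%:P) ^+ k %| V i 0].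
have P0 : exists k, P k by exists 0%N; apply/forallP=> i; rewrite expr0 dvd1p.
have Pb k : P k -> (k <= size (V i0 0%R))%N.
  move/forallP/(_ i0)/(dvdp_leq V0); rewrite size_exp_XsubC; exact: ltnW.
(* the common multiplicity of rho as a root of the entries of V *)
have [k /forallP Pk kmax] := ex_maxnP P0 Pb.
pose W : 'cV[{poly R}]_n := \col_i (V i 0 %/ ('X - rho%:P) ^+ k).
have VW i : V i 0 = W i 0 * ('X - rho%:P) ^+ k by rewrite [W i 0]mxE divpK.
pose w := map_mx (horner_eval rho) W.
have W_ge0 r i : rho < r -> 0 <= (W i 0).[r].
  move=> lt_r; have [x Hx] := above r lt_r.
  have := resolvent_ge0 A_ge0 Hx i.
  rewrite -/V VW hornerM horner_exp !hornerE pmulr_lge0 //.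
  by rewrite exprn_gt0 // subr_gt0.
have w_ge0 i : 0 <= w i 0.
  by rewrite mxE; apply: horner_ge0_right => r; apply: W_ge0.
pose U := char_poly_mx A *m W.
have UE i : U i 0 * ('X - rho%:P) ^+ k = char_poly A ^+ 2.
  have := congr1 (fun M : 'cV_n => M i 0) (resolventE A).
  rewrite [RHS]mxE => <-.
  have -> : resolvent A = ('X - rho%:P) ^+ k *: W.
    by apply/matrixP=> ? j; rewrite ord1 [RHS]mxE mulrC -VW.
  by rewrite -scalemxAr [RHS]mxE mulrC.
have Uw i : (U i 0).[rho] = rho * w i 0 - (A *m w) i 0.
  by rewrite horner_char_poly_mx [X in _ = rho * X - _]mxE.
have U_ge0 i : 0 <= (U i 0).[rho].
  apply: horner_ge0_right => r lt_r.
  have : 0 <= (U i 0 * ('X - rho%:P) ^+ k).[r] by rewrite UE horner_exp sqr_ge0.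
  rewrite hornerM horner_exp !hornerE pmulr_lge0 //.
  by rewrite exprn_gt0 // subr_gt0.
have Ueq i : U i 0 = U i0 0.
  apply: (@mulIf _ (('X - rho%:P) ^+ k)); last by rewrite !UE.
  by rewrite expf_neq0 // polyXsubC_eq0.
have [U0|U0] := eqVneq (U i0 0).[rho] 0.
  exists w; split=> //.
    apply/eqP => w0; suff : P k.+1 by move/kmax; rewrite ltnn.
    apply/forallP=> i; rewrite VW exprS; apply: dvdp_mul => //.
    rewrite dvdp_XsubCl rootE.
    by have /matrixP/(_ i 0) := w0; rewrite !mxE => /eqP.
  apply/matrixP=> i j; rewrite ord1 [RHS]mxE; apply/esym/eqP.
  by rewrite -subr_eq0 -Uw Ueq U0.
(* otherwise w would certify that rho is not an eigenvalue *)
exfalso; suff Hw : supersolution A rho w.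
  by have := supersolution_not_root A_ge0 Hw; rewrite rt.
apply: supersolution_of_strict => // i.
rewrite -subr_gt0 -Uw lt_neqAle U_ge0 andbT eq_sym.
by rewrite Ueq.
Qed.

End Perron.

(** * Constant row sums *)

(** A simultaneous permutation of rows and columns that lists [S]
    first. *)
Lemma set_split_bij (n : nat) (S : {set 'I_n}) :
  exists2 h : 'I_(#|S| + #|~: S|) -> 'I_n, bijective h &
    (forall i, h (lshift _ i) \in S) /\ (forall j, h (rshift _ j) \notin S).
Proof.
pose h (k : 'I_(#|S| + #|~: S|)) : 'I_n :=
  match fintype.split k with
  | inl i => enum_val i
  | inr j => enum_val j
  end.
have hl i : h (lshift _ i) = enum_val i.
  by rewrite /h (unsplitK (inl i)).
have hr j : h (rshift _ j) = enum_val j.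
  by rewrite /h (unsplitK (inr j)).
have hlS i : h (lshift _ i) \in S by rewrite hl enum_valP.
have hrS j : h (rshift _ j) \notin S.
  by rewrite hr; have := enum_valP j; rewrite inE.
exists h => //; apply: inj_card_bij; last by rewrite !card_ord cardsC card_ord.
move=> k l; case: (split_ordP k) => i ->; case: (split_ordP l) => j ->.
- by rewrite !hl => /enum_val_inj ->.
- by move=> e; have := hlS i; rewrite e (negPf (hrS j)).
- by move=> e; have := hlS j; rewrite -e (negPf (hrS i)).
- by rewrite !hr => /enum_val_inj ->.
Qed.

(** If [rho] is not an eigenvalue, scaling by a positive [x] with
    [A x < rho x] bounds the row sums by [rho].  Otherwise the support of a
    Perron vector [x] splits off a diagonal block on which [x] is positive,
    with zeros below it.  Scaling by [x] makes the row sums of this block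
    equal to [rho], and induction bounds those of the other diagonal block.
    The characteristic polynomial is unchanged when the upper off-diagonal
    block is cleared and the lower one is chosen so as to complete the
    remaining row sums.  The inequality in the conclusion keeps the induction
    going, since the second block need not have [rho] as an eigenvalue. *)
Lemma row_sum_realization (R : realType) (n : nat) (A : 'M[R]_n) (rho : R) :
  (forall i j, 0 <= A i j) ->
  (forall r, root (char_poly A) r -> r <= rho) ->
  exists B : 'M[R]_n,
    [/\ forall i j, 0 <= B i j, char_poly B = char_poly A,
        forall i, \sum_j B i j <= rho &
        root (char_poly A) rho -> forall i, \sum_j B i j = rho].
Proof.
elim/ltn_ind: n => n IH in A *; move=> A_ge0 rho_max.
have [rt|nrt] := boolP (root (char_poly A) rho); last first.
  have [r le_r|x Hx] := supersolution_exists A_ge0 (rho := rho).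
    apply/negP=> rtr; move: le_r (rho_max r rtr) nrt => le_r ge_r.
    by rewrite (le_anti (introT andP (conj le_r ge_r))) rtr.
  have x0 i : 0 < x i 0 by case: (Hx i).
  exists (\matrix_(i, j) (A i j * x j 0 / x i 0)); split.
  - by move=> i j; rewrite mxE !mulr_ge0 ?invr_ge0 // ltW.
  - by rewrite char_poly_scaling // => i; rewrite gt_eqF.
  - move=> i; rewrite scaling_row_sum ler_pdivrMr //.
    by case: (Hx i) => _ /ltW.
  - by [].
have [x [x_ge0 x_neq0 Ax]] := perron_vector A_ge0 rt rho_max.
pose S := [set i | x i 0 != 0].
have [h hbij [hl hr]] := set_split_bij S.
have x_gt0 i : 0 < x (h (lshift _ i)) 0.
  by have := hl i; rewrite inE lt_neqAle x_ge0 eq_sym => ->.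
have x_eq0 i : x (h (rshift _ i)) 0 = 0.
  by have := hr i; rewrite inE negbK => /eqP.
pose A' := mxsub h h A.
have Adl0 : dlsubmx A' = 0.
  apply/matrixP=> i j; rewrite !mxE.
  have /matrixP/(_ (h (rshift _ i)) 0) := Ax.
  rewrite !mxE x_eq0 mulr0 => /psumr_eq0P H.
  have /eqP := H (fun k _ => mulr_ge0 (A_ge0 _ k) (x_ge0 k)) (h (lshift _ j)) isT.
  by rewrite mulf_eq0 (gt_eqF (x_gt0 j)) orbF => /eqP.
pose A1 := ulsubmx A'; pose A3 := drsubmx A'.
have cpA : char_poly A = char_poly A1 * char_poly A3.
  by rewrite -(char_poly_reindex A hbij) -/A' -[A']submxK Adl0 char_poly_ublock.
have [i0 Si0] : exists i, i \in S.
  apply/set0Pn/eqP => S0; case/eqP: x_neq0; apply/matrixP=> i j; rewrite ord1 mxE.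
  apply/eqP; have : i \notin S by rewrite S0 inE.
  by rewrite inE negbK.
have nE : (#|S| + #|~: S|)%N = n by rewrite cardsC card_ord.
have p0 : (0 < #|S|)%N by apply/card_gt0P; exists i0.
have qn : (#|~: S| < n)%N by rewrite -[ltnRHS]nE -{1}[#|~: S|]add0n ltn_add2r.
have [i j|r rtr|B3 [B3_ge0 cpB3 B3_le _]] := IH _ qn A3.
- by rewrite !mxE.
- by apply: rho_max; rewrite cpA rootM rtr orbT.
pose x1 : 'cV[R]_#|S| := \col_i x (h (lshift _ i)) 0.
have x1_gt0 i : 0 < x1 i 0 by rewrite mxE.
have A1x i : (A1 *m x1) i 0 = rho * x1 i 0.
  have /matrixP/(_ (h (lshift _ i)) 0) := Ax.
  rewrite [RHS]mxE mxE (reindex h) /=; last exact: onW_bij.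
  rewrite big_split_ord /= [X in _ + X]big1 ?addr0; last first.
    by move=> k _; rewrite x_eq0 mulr0.
  rewrite [x1 i 0]mxE => <-; rewrite mxE; apply: eq_bigr => k _.
  by rewrite !mxE.
pose B1 : 'M[R]_#|S| := \matrix_(i, j) (A1 i j * x1 j 0 / x1 i 0).
have B1_sum i : \sum_j B1 i j = rho.
  by rewrite scaling_row_sum A1x mulfK // gt_eqF.
pose F : 'M[R]_(#|~: S|, #|S|) :=
  \matrix_(i, j) (if j == Ordinal p0 then rho - \sum_k B3 i k else 0).
have F_sum i : \sum_j F i j = rho - \sum_k B3 i k.
  rewrite (bigD1 (Ordinal p0)) //= mxE eqxx [X in _ + X]big1 ?addr0 // => j jp.
  by rewrite mxE (negPf jp).
suff [B HB] : exists B : 'M[R]_(#|S| + #|~: S|),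
   [/\ forall i j, 0 <= B i j, char_poly B = char_poly A &
       forall i, \sum_j B i j = rho].
  move: (#|S| + #|~: S|)%N nE B HB => m mn B [H1 H2 H3]; subst m.
  by exists B; split=> // i; rewrite H3.
exists (block_mx B1 0 F B3); split.
- move=> i j; case: (split_ordP i) => k ->; case: (split_ordP j) => l ->;
    rewrite ?block_mxEul ?block_mxEur ?block_mxEdl ?block_mxEdr //.
  + by rewrite !mxE !mulr_ge0 ?invr_ge0 ?x_ge0 // ltW.
  + by rewrite mxE.
  + by rewrite mxE; case: ifP => // _; rewrite subr_ge0.
- rewrite char_poly_lblock cpA cpB3 char_poly_scaling // => i.
  by rewrite gt_eqF.
- move=> i; rewrite big_split_ord /=; case: (split_ordP i) => k ->.
  + under eq_bigr do rewrite block_mxEul.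
    under [X in _ + X]eq_bigr do rewrite block_mxEur mxE.
    by rewrite B1_sum big1 ?addr0.
  + under eq_bigr do rewrite block_mxEdl.
    under [X in _ + X]eq_bigr do rewrite block_mxEdr.
    by rewrite F_sum subrK.
Qed.

(** * Inequalities for a hexagon whose triangles are small *)

Section Hexagon.
Variable R : realFieldType.
Implicit Types x y z a e b d : R.

(** The hypothesis bounds [z] by the golden section [0.618...], and the
    conclusion already holds up to [(1 + sqrt 17) / 8 = 0.640...]. *)
Lemma golden_gap z : 0 <= z -> z * (1 + z) <= 1 -> z * z - z / 4 <= 1 / 4.
Proof.
move=> z0 zz.
have z1 : z <= 16 / 25.
  rewrite leNgt; apply/negP => h.
  have : 16 / 25 * (16 / 25) <= z * z by apply: ler_pM; lra.
  lra.
have : z * z <= z * (16 / 25) by apply: ler_wpM2l.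
lra.
Qed.

(** The five lemmas [core_*] are the cases of [hexagon_core], where the
    meaning of the variables is explained; the area inequality is the one for
    [p q r].  Here it is affine in [e] with nonnegative slope, so [e] may be
    lowered to [y]; what remains is [x + y + z <= 1 + (b - z) (y - a)]. *)
Lemma core_left_large x y z a e b d :
  0 <= z -> z <= y -> z * (1 + y) <= 1 ->
  0 <= a -> a <= 1 - x -> 0 <= b -> 0 <= d -> b + d = 1 - y ->
  e * (1 - x - b) + a * (1 - z - d) - a * e <= 1 - (x + z) * (1 + y) ->
  a <= 1 - x - b -> y <= e -> x + y + z <= 5 / 4.
Proof.
move=> z0 zy hz a0 ax b0 d0 bd D aP ye; rewrite leNgt; apply/negP => S.
have k1 : (e - y) * (1 - x - b - a) >= 0 by apply: mulr_ge0; lra.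
have k2 : x + y + z <= 1 + (b - z) * (y - a).
  have dE : d = 1 - y - b by lra.
  move: D; rewrite dE => D; lra.
have [zb|bz] := lerP z b; have [ay|ya] := lerP a y.
- have q : y * (1 - y) <= 1 / 4 by have := sqr_ge0 (y - 1/2); lra.
  have q2 : (b - z) * (y - a) <= (1 - y) * y.
    by apply: ler_pM; lra.
  lra.
- have : (b - z) * (a - y) >= 0 by apply: mulr_ge0; lra. lra.
- have : (z - b) * (y - a) >= 0 by apply: mulr_ge0; lra. lra.
- have : (z - b) * (a - y) <= z * (z - 1 / 4) by apply: ler_pM; lra.
  have : z * z <= y * z by apply: ler_wpM2r.
  have zz1 : z * (1 + z) <= 1 by have := ler_wpM2r z0 zy; lra.
  have := golden_gap z0 zz1; lra.
Qed.

(** With [P = 1 - x - b] and [Q = 1 - z - d], the left-hand side of the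
    area inequality is [P Q - (a - P) (e - Q)], where the last two factors
    are at most [b] and [d]. *)
Lemma core_both_large x y z a e b d :
  0 <= x -> 0 <= z -> x <= y -> z <= y -> z * (1 + y) <= 1 -> x * (1 + y) <= 1 ->
  a <= 1 - x -> e <= 1 - z -> 0 <= b -> 0 <= d -> b + d = 1 - y ->
  e * (1 - x - b) + a * (1 - z - d) - a * e <= 1 - (x + z) * (1 + y) ->
  1 - x - b <= a -> 1 - z - d <= e -> x + y + z <= 5 / 4.
Proof.
move=> x0 z0 xy zy hz hx ax ez b0 d0 bd D aP eQ.
have k1 : (e - (1 - z - d)) * (a - (1 - x - b)) <= d * b by apply: ler_pM; lra.
have k2 : x * z + (x + z) * y <= (1 - x) * d + (1 - z) * b by lra.
wlog xz : x z a e b d x0 z0 xy zy hz hx ax ez b0 d0 bd D aP eQ k1 k2 / x <= z.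
  move=> h; have [xz|zx] := lerP x z; first exact: (h x z a e b d).
  suff : z + y + x <= 5 / 4 by lra.
  by apply: (h z x e a d b) => //; lra.
have k3 : (1 - z) * b <= (1 - x) * b by apply: ler_wpM2r; lra.
have k4 : b = 1 - y - d by lra.
have k5 : (x + y) * (1 + z) <= 1 by move: k2 k3; rewrite k4; lra.
have zz : z * z <= y * z by apply: ler_wpM2r.
rewrite leNgt; apply/negP => S.
have : (x + y - (5 / 4 - z)) * (1 + z) > 0 by apply: mulr_gt0; lra.
have zz1 : z * (1 + z) <= 1 by lra.
have := golden_gap z0 zz1; lra.
Qed.

(** In this case [(1 - x - b) (1 - z - d)] is at most the left-hand side
    of the area inequality, and [y <= 1 - z - d]. *)
Lemma core_mixed x y z a e b d :
  0 <= z -> 0 <= y -> 0 <= b -> 0 <= d -> b + d = 1 - y ->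
  e * (1 - x - b) + a * (1 - z - d) - a * e <= 1 - (x + z) * (1 + y) ->
  1 - x - b <= a -> e <= 1 - z - d -> y <= e -> 0 <= 1 - x - b ->
  x + y + z <= 5 / 4.
Proof.
move=> z0 y0 b0 d0 bd D aP eQ ye P0.
have k1 : (a - (1 - x - b)) * (1 - z - d - e) >= 0 by apply: mulr_ge0; lra.
have k2 : y * (1 - x - b) <= e * (1 - x - b) by apply: ler_wpM2r; lra.
have k2' : e * (1 - x - b) <= (1 - z - d) * (1 - x - b) by apply: ler_wpM2r; lra.
have k3 : x + y + z <= 1 + y * (b - z) by lra.
have k4 : y * b <= y * (1 - y) by apply: ler_wpM2l; lra.
have k5 : 0 <= y * z by apply: mulr_ge0.
have := sqr_ge0 (y - 1/2); lra.
Qed.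

(** When [y] is below the golden section, [(x + z) (1 + y) <= 1] is
    enough, and it follows from the nonnegativity of the left-hand side of
    the area inequality. *)
Lemma core_small x y z a e b d :
  0 <= x -> 0 <= z -> x <= y -> z <= y ->
  0 <= a -> a <= 1 - x -> 0 <= e -> e <= 1 - z ->
  0 <= b -> 0 <= d -> b + d = 1 - y ->
  e * (1 - x - b) + a * (1 - z - d) - a * e <= 1 - (x + z) * (1 + y) ->
  y * (1 + y) <= 1 ->
  x + y + z <= 5 / 4.
Proof.
move=> x0 z0 xy zy a0 ax e0 ez b0 d0 bd D y1.
have k : 0 <= e * (1 - x - b) + a * (1 - z - d) - a * e.
  have -> : e * (1 - x - b) + a * (1 - z - d) - a * e
    = a * (y - z + b - e) + e * (y - x + d).
    have -> : d = 1 - y - b by lra. ring.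
  have p1 : 0 <= e * (y - x + d) by apply: mulr_ge0; lra.
  have [h|h] := lerP 0 (y - z + b - e).
    by rewrite addr_ge0 // mulr_ge0.
  have p2 : (1 - x) * (y - z + b - e) <= a * (y - z + b - e).
    by apply: ler_wnM2r; lra.
  have p3 : b * e <= b * (1 - z) by apply: ler_wpM2l; lra.
  have p4 : (1 - y) * (y - z) <= (1 - x) * (y - z) by apply: ler_wpM2r; lra.
  have dE : d = 1 - y - b by lra.
  suff : 0 <= (1 - x) * (y - z) + b * (z - x).
    by move: p2; rewrite dE; lra.
  have [xz|zx] := lerP x z.
    by apply: addr_ge0; apply: mulr_ge0; lra.
  have p5 : b * (x - z) <= (1 - y) * (x - z) by apply: ler_wpM2r; lra.
  have p6 : (1 - y) * (x - z) <= (1 - y) * (y - z) by apply: ler_wpM2l; lra.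
  lra.
rewrite leNgt; apply/negP => S.
have : (x + z - (5 / 4 - y)) * (1 + y) > 0 by apply: mulr_gt0; lra.
have y0 : 0 <= y by lra.
have := golden_gap y0 y1; lra.
Qed.

(** The critical case, which contains the configurations with
    [x + y + z = 5 / 4].  Set [W = e b + a d].  The two bounds on [x y] and
    [y z] add up to [y (1 + x + z) - 1 <= W]; inserted into the area
    inequality they give
    [(y^2 + y - 1) W <= y (1 - y) (1 - (x + z) (1 + y))].  When
    [x + z = 5 / 4 - y], the resulting lower bound of [(y^2 + y - 1) W]
    exceeds this upper bound by [(3 y / 2 - 1)^2], and the gap increases
    with [x + z]. *)
Lemma core_main x y z a e b d :
  0 <= y ->
  0 <= a -> 0 <= e -> a <= y -> e <= y ->
  0 <= b -> 0 <= d -> b + d = 1 - y ->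
  x * y <= b + a * d -> y * z <= d + e * b ->
  e * (1 - x - b) + a * (1 - z - d) - a * e <= 1 - (x + z) * (1 + y) ->
  1 <= y * (1 + y) ->
  x + y + z <= 5 / 4.
Proof.
move=> y0 a0 e0 ay ey b0 d0 bd E1 E2 D y1.
have yp : 0 < y.
  by rewrite lt_neqAle y0 andbT; apply/eqP=> y00; move: y1; rewrite -y00; lra.
have m0 : 0 <= 1 - y by lra.
(* the area inequality times y, with the bounds on x y and y z inserted *)
have D1 : e * (y - y * b - (b + a * d)) + a * (y - y * d - (d + e * b)) - y * a * e
   <= y * (1 - (x + z) * (1 + y)).
  have q1 : e * (x * y) <= e * (b + a * d) by apply: ler_wpM2l.
  have q2 : a * (y * z) <= a * (d + e * b) by apply: ler_wpM2l.
  have q3 : y * (e * (1 - x - b) + a * (1 - z - d) - a * e)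
     <= y * (1 - (x + z) * (1 + y)) by apply: ler_wpM2l.
  lra.
have q4 : a * e * d <= y * (e * d)
  by rewrite -mulrA; apply: ler_wpM2r => //; apply: mulr_ge0.
have q5 : a * e * b <= y * (a * b).
  by rewrite (mulrC a) -mulrA; apply: ler_wpM2r => //; apply: mulr_ge0.
set W := e * b + a * d.
have D2 : (y * y + y - 1) * W <= (1 - y) * y * (1 - (x + z) * (1 + y)).
  have : (1 - y) * (e * (y - y * b - (b + a * d))
                    + a * (y - y * d - (d + e * b)) - y * a * e)
    <= (1 - y) * (y * (1 - (x + z) * (1 + y))) by apply: ler_wpM2l.
  have dE : d = 1 - y - b by lra.
  move: q4 q5; rewrite /W dE; lra.
have K0 : 0 <= y * y + y - 1 by lra.
have D3 : (y * y + y - 1) * (y * (1 + (x + z)) - 1) <= (y * y + y - 1) * W.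
  by apply: ler_wpM2l => //; rewrite /W; lra.
rewrite leNgt; apply/negP => S.
have S' : 0 < x + z - (5 / 4 - y) by lra.
have p1 : 0 <= (y * y + y - 1) * y * (x + z - (5 / 4 - y)).
  by rewrite !mulr_ge0 // ltW.
have p2 : 0 <= (1 - y) * y * (1 + y) * (x + z - (5 / 4 - y)).
  by rewrite !mulr_ge0 //; lra.
have p3 : 0 < y * (x + z - (5 / 4 - y)) by rewrite mulr_gt0.
have p4 : 0 < y * y * (x + z - (5 / 4 - y)) by rewrite mulr_gt0 // mulr_gt0.
have := sqr_ge0 (3 * y / 2 - 1).
lra.
Qed.

(** In barycentric coordinates with respect to the triangle [A B C], take
    [p = (- x, 1 - a, x + a)], [q = (y + b, - y, y + d)] and
    [r = (z + e, 1 - e, - z)].  Up to rearrangement, the last three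
    hypotheses say that the areas of the triangles [A p q], [C q r] and
    [p q r] are at most that of [A B C]. *)
Lemma hexagon_core x y z a e b d :
  0 <= x -> 0 <= z -> x <= y -> z <= y -> z * (1 + y) <= 1 -> x * (1 + y) <= 1 ->
  0 <= a -> a <= 1 - x -> 0 <= e -> e <= 1 - z ->
  0 <= b -> 0 <= d -> b + d = 1 - y ->
  x * y <= b + a * d -> y * z <= d + e * b ->
  e * (1 - x - b) + a * (1 - z - d) - a * e <= 1 - (x + z) * (1 + y) ->
  x + y + z <= 5 / 4.
Proof.
move=> x0 z0 xy zy hz hx a0 ax e0 ez b0 d0 bd E1 E2 D.
have y0 : 0 <= y by lra.
have [y1|/ltW y1] := lerP (y * (1 + y)) 1.
  exact: (@core_small x y z a e b d).
have [ey|/ltW ye] := lerP e y; have [ay|/ltW ya] := lerP a y.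
- exact: (@core_main x y z a e b d).
- have [eQ|/ltW eQ] := lerP e (1 - z - d).
    suff : z + y + x <= 5 / 4 by lra.
    apply: (@core_left_large z y x e a d b) => //; lra.
  have [aP|/ltW aP] := lerP a (1 - x - b); last first.
    exact: (@core_both_large x y z a e b d).
  have Q0 : 0 <= 1 - z - d by lra.
  suff : z + y + x <= 5 / 4 by lra.
  apply: (@core_mixed z y x e a d b) => //; lra.
- have [aP|/ltW aP] := lerP a (1 - x - b).
    exact: (@core_left_large x y z a e b d).
  have [eQ|/ltW eQ] := lerP e (1 - z - d); last first.
    exact: (@core_both_large x y z a e b d).
  apply: (@core_mixed x y z a e b d) => //; lra.
- have [aP|/ltW aP] := lerP a (1 - x - b).
    exact: (@core_left_large x y z a e b d).
  have [eQ|/ltW eQ] := lerP e (1 - z - d); last first.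
    exact: (@core_both_large x y z a e b d).
  suff : z + y + x <= 5 / 4 by lra.
  apply: (@core_left_large z y x e a d b) => //; lra.
Qed.

(** In barycentric coordinates, [p = (- x, p2, p3)], [q = (q1, - y, q3)]
    and [r = (r1, r2, - z)], where [q] is the deepest of the three points.
    The bounds by [1] are areas of triangles: of two vertices and one point,
    then of [A p q], [B p q], [B q r], [C q r], and of [p q r]. *)
Lemma hexagon_max x y z p2 p3 q1 q3 r1 r2 :
  0 <= x -> 0 <= z -> x <= y -> z <= y ->
  p2 + p3 = 1 + x -> q1 + q3 = 1 + y -> r1 + r2 = 1 + z ->
  p2 <= 1 -> p3 <= 1 -> q1 <= 1 -> q3 <= 1 -> r1 <= 1 -> r2 <= 1 ->
  p2 * q3 + y * p3 <= 1 -> x * q3 + p3 * q1 <= 1 ->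
  q1 * z + q3 * r1 <= 1 -> q1 * r2 + y * r1 <= 1 ->
  - x * (y * z - q3 * r2) - p2 * (- q1 * z - q3 * r1)
    + p3 * (q1 * r2 + y * r1) <= 1 ->
  x + y + z <= 5 / 4.
Proof.
move=> x0 z0 xy zy ps qs rs p2l p3l q1l q3l r1l r2l apq bpq bqr cqr pqr.
have [p2E q1E r2E] : [/\ p2 = 1 + x - p3, q1 = 1 + y - q3 & r2 = 1 + z - r1].
  by split; lra.
subst p2 q1 r2.
have hx : 0 <= (1 + y - q3) * (p3 - x) by apply: mulr_ge0; lra.
have hz : 0 <= q3 * (r1 - z) by apply: mulr_ge0; lra.
apply: (@hexagon_core x y z (p3 - x) (r1 - z) (1 - q3) (q3 - y)) => //; try lra.

Qed.

(** The area bounds are now invariant under cyclic permutations of the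
    three coordinates, which make the deepest point the middle one. *)
Lemma hexagon_le x y z p2 p3 q1 q3 r1 r2 :
  0 <= x -> 0 <= y -> 0 <= z ->
  p2 + p3 = 1 + x -> q1 + q3 = 1 + y -> r1 + r2 = 1 + z ->
  p2 <= 1 -> p3 <= 1 -> q1 <= 1 -> q3 <= 1 -> r1 <= 1 -> r2 <= 1 ->
  p2 * q3 + y * p3 <= 1 -> x * q3 + p3 * q1 <= 1 ->
  q1 * z + q3 * r1 <= 1 -> q1 * r2 + y * r1 <= 1 ->
  r2 * p3 + z * p2 <= 1 -> r1 * p2 + x * r2 <= 1 ->
  - x * (y * z - q3 * r2) - p2 * (- q1 * z - q3 * r1)
    + p3 * (q1 * r2 + y * r1) <= 1 ->
  x + y + z <= 5 / 4.
Proof.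
move=> x0 y0 z0 ps qs rs p2l p3l q1l q3l r1l r2l apq bpq bqr cqr arp crp pqr.
have [xy|/ltW yx] := lerP x y.
  have [zy|/ltW yz] := lerP z y.
    by apply: (@hexagon_max x y z p2 p3 q1 q3 r1 r2).
  suff : y + z + x <= 5 / 4 by lra.
  by apply: (@hexagon_max y z x q3 q1 r2 r1 p2 p3); lra.
have [zx|/ltW xz] := lerP z x.
  suff : z + x + y <= 5 / 4 by lra.
  by apply: (@hexagon_max z x y r1 r2 p3 p2 q3 q1); lra.
suff : y + z + x <= 5 / 4 by lra.
by apply: (@hexagon_max y z x q3 q1 r2 r1 p2 p3); lra.
Qed.

End Hexagon.

(** With [g = (sqrt 5 - 1) / 2], either both numbers are at most [g], or
    the larger one is a number [y] between [g] and [1], and there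
    [y + 1 / y - 1 <= 2 g]. *)
Lemma pentagon_le (R : rcfType) (x y : R) :
  0 <= x -> 0 <= y -> x * (1 + y) <= 1 -> y * (1 + x) <= 1 ->
  x + y <= Num.sqrt 5 - 1.
Proof.
wlog xy : x y / x <= y.
  move=> h x0 y0 hx hy; have [xy|/ltW yx] := lerP x y; first exact: h.
  by rewrite addrC; exact: h.
move=> x0 y0 hx hy.
set s := Num.sqrt 5.
have s0 : 0 <= s by rewrite sqrtr_ge0.
have ss : s * s = 5 by rewrite -expr2 sqr_sqrtr.
have [yg|yg] := lerP y ((s - 1) / 2); first by lra.
have y1 : y <= 1 by have := mulr_ge0 y0 x0; lra.
have s1 : 1 < s.
  rewrite ltNge; apply/negP => h.
  have : s * s <= 1 * 1 by apply: ler_pM.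
  lra.
have k : (y - (s - 1) / 2) * ((s + 1) / 2 - y) >= 0 by apply: mulr_ge0; lra.
rewrite leNgt; apply/negP => S.
have : 0 < y * (x + y - (s - 1)) by apply: mulr_gt0; lra.
lra.
Qed.

(** The areas of [A p q] and [B p q] are affine in the position of [p] and in
    that of [q]; since no coordinate exceeds [1], they are at least
    [y (1 + x)] and [x (1 + y)], their values at extreme positions. *)
Lemma pair_le (R : rcfType) (x y p2 p3 q1 q3 : R) :
  0 <= x -> 0 <= y -> p2 + p3 = 1 + x -> q1 + q3 = 1 + y ->
  p2 <= 1 -> p3 <= 1 -> q1 <= 1 -> q3 <= 1 ->
  p2 * q3 + y * p3 <= 1 -> x * q3 + p3 * q1 <= 1 ->
  x + y <= Num.sqrt 5 - 1.
Proof.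
move=> x0 y0 ps qs p2l p3l q1l q3l apq bpq.
have hp : p3 = 1 + x - p2 by lra.
have hq : q1 = 1 + y - q3 by lra.
subst p3 q1.
have k1 : 0 <= p2 * (q3 - y) by apply: mulr_ge0; lra.
have k2 : 0 <= (1 - p2) * (1 + y - q3) by apply: mulr_ge0; lra.
apply: pentagon_le => //; lra.
Qed.

(** * Largest triangles *)

Definition o0 : 'I_3 := @Ordinal 3 0 isT.
Definition o1 : 'I_3 := @Ordinal 3 1 isT.
Definition o2 : 'I_3 := @Ordinal 3 2 isT.

Lemma ord3_ind (P : 'I_3 -> Prop) : P o0 -> P o1 -> P o2 -> forall k, P k.
Proof.
move=> P0 P1 P2 [[|[|[|//]]] k3];
  [move: P0 | move: P1 | move: P2]; congr P; exact: val_inj.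
Qed.

Lemma sum3 (V : nmodType) (F : 'I_3 -> V) : \sum_i F i = F o0 + F o1 + F o2.
Proof.
rewrite !big_ord_recl big_ord0 addr0 addrA.
by congr (F _ + F _ + F _); apply: val_inj.
Qed.

Lemma det3 (R : comNzRingType) (M : 'M[R]_3) :
  \det M = M o0 o0 * (M o1 o1 * M o2 o2 - M o1 o2 * M o2 o1)
         - M o0 o1 * (M o1 o0 * M o2 o2 - M o1 o2 * M o2 o0)
         + M o0 o2 * (M o1 o0 * M o2 o1 - M o1 o1 * M o2 o0).
Proof.
(* naming the entries by numbers lets the indices compute *)
pose m a b := M (inord a) (inord b).
have E i j : M i j = m i j by rewrite /m !inord_val.
rewrite (expand_det_row _ o0) sum3 /cofactor.
rewrite !(expand_det_row _ ord0) !big_ord_recl !big_ord0 /cofactor !det_mx11 !mxE.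
rewrite !E /= /bump /=; ring.
Qed.

Definition tri (T : Type) (i j l : T) (k : 'I_3) : T := tnth [tuple i; j; l] k.

Lemma triE (T : Type) (i j l : T) :
  (tri i j l o0 = i) * (tri i j l o1 = j) * (tri i j l o2 = l).
Proof. by []. Qed.

Lemma det_tri (R : comNzRingType) (n : nat) (Y : 'M[R]_(n, 3)) i j l :
  \det (rowsub (tri i j l) Y) =
    Y i o0 * (Y j o1 * Y l o2 - Y j o2 * Y l o1)
  - Y i o1 * (Y j o0 * Y l o2 - Y j o2 * Y l o0)
  + Y i o2 * (Y j o0 * Y l o1 - Y j o1 * Y l o0).
Proof. by rewrite det3 !mxE. Qed.

(** Determinants of [r] rows are volumes of simplices, and there are
    finitely many of them; one of them is nonzero by full rank. *)
Lemma max_rowsub (R : realFieldType) (n r : nat) (X : 'M[R]_(n, r)) :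
  row_full X ->
  exists2 f : 'I_r -> 'I_n, rowsub f X \in unitmx &
    forall g : 'I_r -> 'I_n, `|\det (rowsub g X)| <= `|\det (rowsub f X)|.
Proof.
move=> Xfull; pose f0 := fullrankfun Xfull.
have [f _ fmax] := @arg_maxP _ _ _ f0 xpredT
  (fun g : {ffun 'I_r -> 'I_n} => `|\det (rowsub g X)|) isT.
have f0_unit : rowsub f0 X \in unitmx.
  by rewrite -row_full_unit fullrowsub_full.
exists f.
  rewrite unitmxE unitfE -normr_gt0; apply: lt_le_trans (fmax f0 isT).
  by rewrite normr_gt0 -unitfE -unitmxE.
move=> g; have := fmax [ffun k => g k] isT; apply: le_trans.
rewrite (_ : rowsub [ffun k => g k] X = rowsub g X) //.
by apply/matrixP=> i j; rewrite !mxE ffunE.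
Qed.

Lemma gamma_le (R : realType) (m n : nat) :
  (3 <= m)%N -> (m <= n)%N -> gamma R m <= gamma R n.
Proof.
have s2 : 2 <= Num.sqrt 5 :> R.
  by rewrite -(@ler_sqr R) ?nnegrE ?sqrtr_ge0 // sqr_sqrtr //; lra.
have s9 : Num.sqrt 5 <= 9 / 4 :> R.
  rewrite -(@ler_sqr R) ?nnegrE ?sqrtr_ge0 //; last by lra.
  by rewrite sqr_sqrtr //; lra.
case: m => [|[|[|[|[|[|m]]]]]] // _; case: n => [|[|[|[|[|[|n]]]]]] //= _; lra.
Qed.

Section Ratio.
Variables (R : realType) (n : nat) (Y : 'M[R]_(n, 3)) (f p : 'I_3 -> 'I_n).
Hypothesis Y_f : rowsub f Y = 1%:M.
Hypothesis Y_sum : forall i, \sum_k Y i k = 1.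
Hypothesis Y_det : forall g : 'I_3 -> 'I_n, \det (rowsub g Y) <= 1.
Hypothesis Y_p : forall k, Y (p k) k <= 0.

Lemma Yf l k : Y (f l) k = (l == k)%:R.
Proof. by have /matrixP/(_ l k) := Y_f; rewrite !mxE. Qed.

Lemma tri_le1 i j l :
    Y i o0 * (Y j o1 * Y l o2 - Y j o2 * Y l o1)
  - Y i o1 * (Y j o0 * Y l o2 - Y j o2 * Y l o0)
  + Y i o2 * (Y j o0 * Y l o1 - Y j o1 * Y l o0) <= 1.
Proof. by rewrite -det_tri. Qed.

(** A barycentric coordinate of a point is the area of the triangle in
    which this point replaces a vertex. *)
Lemma coord_le1 i k : Y i k <= 1.
Proof.
move: k; apply: ord3_ind.
- by have := tri_le1 i (f o1) (f o2); rewrite !Yf /=; lra.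
- by have := tri_le1 (f o0) i (f o2); rewrite !Yf /=; lra.
- by have := tri_le1 (f o0) (f o1) i; rewrite !Yf /=; lra.
Qed.

(** The points [p k] outside the triangle are not among its vertices, and
    a point with two negative coordinates would have a third one larger than
    [1]. *)
Lemma card_exposed : (3 + #|[set k | (Y (p k) k < 0)%R]| <= n)%N.
Proof.
set K := [set k | _].
have f_inj : injective f.
  move=> k l e; have := Yf k l; rewrite e Yf eqxx => /eqP.
  by rewrite eqr_nat; have [->|] := eqVneq l k.
have p_inj : {in K &, injective p}.
  move=> k l; rewrite !inE => pk pl e; apply/eqP; apply: contraTT pl => kl.
  rewrite -e -leNgt; have := Y_sum (p k); have := coord_le1 (p k).
  move: (p k) kl pk => i; rewrite sum3 => kl pk le1.
  have := le1 o0; have := le1 o1; have := le1 o2; move: k l kl pk {e}.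
  by apply: ord3_ind; apply: ord3_ind => //; lra.
have dis : [disjoint f @: [set: 'I_3] & p @: K].
  apply/pred0P => i /=; apply/negP=> /andP[/imsetP[k _ ->] /imsetP[l]].
  by rewrite inE => h e; move: h; rewrite -e Yf ltNge ler0n.
have := subset_leq_card (finset.subsetT ((f @: [set: 'I_3])%SET :|: (p @: K)%SET)%SET).
rewrite finset.cardsU finset.disjoint_setI0 // cards0 subn0.
rewrite (card_imset _ f_inj) (card_in_imset p_inj).
by rewrite !cardsT !card_ord.
Qed.

(** When [p k] minimizes column [k], the left-hand side is the homothety
    ratio between the circumscribed triangle and the inscribed one. *)
Lemma triangle_ratio : 1 - \sum_k Y (p k) k <= gamma R n.
Proof.
rewrite sum3; have := card_exposed.
have -> : #|[set k | (Y (p k) k < 0)%R]| =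
  ((Y (p o0) o0 < 0)%R + (Y (p o1) o1 < 0)%R + (Y (p o2) o2 < 0)%R)%N.
  by rewrite -sum1dep_card big_mkcond sum3 /=; do 3!case: ifP.
set P := p o0; set Q := p o1; set T := p o2.
have Px : Y P o0 <= 0 by exact: Y_p.
have Qy : Y Q o1 <= 0 by exact: Y_p.
have Tz : Y T o2 <= 0 by exact: Y_p.
have Ps : Y P o1 + Y P o2 = 1 + - Y P o0 by have := Y_sum P; rewrite sum3; lra.
have Qs : Y Q o0 + Y Q o2 = 1 + - Y Q o1 by have := Y_sum Q; rewrite sum3; lra.
have Ts : Y T o0 + Y T o1 = 1 + - Y T o2 by have := Y_sum T; rewrite sum3; lra.
have P1 := coord_le1 P o1; have P2 := coord_le1 P o2.
have Q0 := coord_le1 Q o0; have Q2 := coord_le1 Q o2.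
have T0 := coord_le1 T o0; have T1 := coord_le1 T o1.
have apq : Y P o1 * Y Q o2 + - Y Q o1 * Y P o2 <= 1.
  by have := tri_le1 (f o0) P Q; rewrite !Yf /=; lra.
have bpq : - Y P o0 * Y Q o2 + Y P o2 * Y Q o0 <= 1.
  by have := tri_le1 (f o1) P Q; rewrite !Yf /=; lra.
have bqr : Y Q o0 * - Y T o2 + Y Q o2 * Y T o0 <= 1.
  by have := tri_le1 (f o1) Q T; rewrite !Yf /=; lra.
have cqr : Y Q o0 * Y T o1 + - Y Q o1 * Y T o0 <= 1.
  by have := tri_le1 (f o2) Q T; rewrite !Yf /=; lra.
have arp : Y T o1 * Y P o2 + - Y T o2 * Y P o1 <= 1.
  by have := tri_le1 (f o0) T P; rewrite !Yf /=; lra.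
have crp : Y T o0 * Y P o1 + - Y P o0 * Y T o1 <= 1.
  by have := tri_le1 (f o2) T P; rewrite !Yf /=; lra.
have pqr := tri_le1 P Q T.
have x0 : 0 <= - Y P o0 by rewrite oppr_ge0.
have y0 : 0 <= - Y Q o1 by rewrite oppr_ge0.
have z0 : 0 <= - Y T o2 by rewrite oppr_ge0.
move/(gamma_le R (leq_addr _ _)); apply: le_trans.
have [Px'|Px'] := ltrP (Y P o0) 0; have [Qy'|Qy'] := ltrP (Y Q o1) 0;
  have [Tz'|Tz'] := ltrP (Y T o2) 0; rewrite /gamma /=; try lra.
- suff : - Y P o0 + - Y Q o1 + - Y T o2 <= 5 / 4 by lra.
  apply: (@hexagon_le _ _ _ _ (Y P o1) (Y P o2)
    (Y Q o0) (Y Q o2) (Y T o0) (Y T o1)) => //; lra.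
- suff : - Y P o0 + - Y Q o1 <= Num.sqrt 5 - 1 by lra.
  exact: (@pair_le _ _ _ (Y P o1) (Y P o2) (Y Q o0) (Y Q o2)).
- suff : - Y T o2 + - Y P o0 <= Num.sqrt 5 - 1 by lra.
  by apply: (@pair_le _ _ _ (Y T o0) (Y T o1) (Y P o2) (Y P o1)) => //; lra.
- suff : - Y Q o1 + - Y T o2 <= Num.sqrt 5 - 1 by lra.
  by apply: (@pair_le _ _ _ (Y Q o2) (Y Q o0) (Y T o1) (Y T o0)) => //; lra.
Qed.

End Ratio.

(** * The complex eigenvector *)

Lemma mulmx_realE (R : rcfType) (n : nat) (B : 'M[R]_n) (z : 'cV[R[i]]_n) i :
  (map_mx (real_complex R) B *m z) i 0 =
  (B *m map_mx (@complex.Re R) z) i 0 +i* (B *m map_mx (@complex.Im R) z) i 0.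
Proof.
have ReD : {morph @complex.Re R : x y / x + y} by case=> ? ? [].
have ImD : {morph @complex.Im R : x y / x + y} by case=> ? ? [].
apply/eqP; rewrite eq_complex !mxE; apply/andP; split; apply/eqP.
  rewrite (big_morph _ ReD (erefl _)); apply: eq_bigr => j _; rewrite !mxE.
  by case: (z j 0) => a b /=; ring.
rewrite (big_morph _ ImD (erefl _)); apply: eq_bigr => j _; rewrite !mxE.
by case: (z j 0) => a b /=; ring.
Qed.

Lemma real_eigenpair (R : rcfType) (n : nat) (B : 'M[R]_n) (b c : R) :
  root (char_poly (map_mx (real_complex R) B)) (b +i* c) ->
  exists u v : 'cV[R]_n,
    [/\ (u != 0) || (v != 0),
        forall i, (B *m u) i 0 = b * u i 0 - c * v i 0 &
        forall i, (B *m v) i 0 = c * u i 0 + b * v i 0].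
Proof.
rewrite rootE horner_char_poly -det_tr => /det0P[w w0].
move/(congr1 trmx); rewrite trmx_mul trmxK trmx0 mulmxBl mul_scalar_mx => /eqP.
rewrite subr_eq0 => /eqP /matrixP E.
exists (map_mx (@complex.Re R) w^T), (map_mx (@complex.Im R) w^T); split.
- apply: contraNT w0; rewrite negb_or !negbK => /andP[/eqP/matrixP u0 /eqP/matrixP v0].
  apply/eqP/matrixP=> i j; rewrite ord1 mxE; apply/eqP; rewrite eq_complex.
  by have := u0 j 0; have := v0 j 0; rewrite !mxE => -> ->; rewrite !eqxx.
- move=> i; have := E i 0; rewrite mulmx_realE !mxE.
  by case: (w 0 i) => x y /= /esym[-> _].
- move=> i; have := E i 0; rewrite mulmx_realE !mxE.
  by case: (w 0 i) => x y /= /esym[_ ->]; rewrite addrC.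
Qed.

(** In the basis [1, u, v], this is the linear map with eigenvector [1] for
    [r] and eigenvector [u + iv] for [b + ic]. *)
Definition rot3 (R : ringType) (r b c : R) : 'M[R]_3 :=
  \matrix_(k, l) tri (tri r 0 0 l) (tri 0 b c l) (tri 0 (- c) b l) k.

Definition frame (R : ringType) (n : nat) (u v : 'cV[R]_n) : 'M[R]_(n, 3) :=
  \matrix_(i, k) tri 1 (u i 0) (v i 0) k.

Lemma mulmx_frame (R : comNzRingType) (n : nat) (B : 'M[R]_n) (u v : 'cV[R]_n)
    (rho b c : R) :
  (forall i, \sum_j B i j = rho) ->
  (forall i, (B *m u) i 0 = b * u i 0 - c * v i 0) ->
  (forall i, (B *m v) i 0 = c * u i 0 + b * v i 0) ->
  B *m frame u v = frame u v *m rot3 rho b c.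
Proof.
move=> Bs Bu Bv; apply/matrixP=> i; apply: ord3_ind; rewrite [RHS]mxE sum3 !mxE !triE.
- rewrite (eq_bigr (B i)) ?Bs; last by move=> j _; rewrite mxE triE mulr1.
  ring.
- have := Bu i; rewrite mxE => e.
  rewrite (eq_bigr (fun j => B i j * u j 0)) ?e; last by move=> j _; rewrite mxE triE.
  ring.
- have := Bv i; rewrite mxE => e.
  rewrite (eq_bigr (fun j => B i j * v j 0)) ?e; last by move=> j _; rewrite mxE triE.
  ring.
Qed.

Lemma char_poly_rot3 (R : comNzRingType) (r b c : R) :
  char_poly (rot3 r b c) = ('X - r%:P) * (('X - b%:P) ^+ 2 + c%:P ^+ 2).
Proof.
by rewrite /char_poly det3 !mxE !triE /= polyCN !polyC0; ring.
Qed.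

(** A linear relation among [1, u, v] is killed by [B^2 - 2 b B + b^2 + c^2]
    up to its first coefficient times [(rho - b)^2 + c^2], which is positive.
    So this coefficient vanishes, and a relation between [u] and [v] alone
    is stable under a quarter turn. *)
Lemma frame_full (R : realFieldType) (n : nat) (B : 'M[R]_n)
    (u v : 'cV[R]_n) (rho b c : R) :
  (0 < n)%N -> c != 0 -> (u != 0) || (v != 0) ->
  B *m frame u v = frame u v *m rot3 rho b c ->
  row_full (frame u v).
Proof.
move=> n0 c0 uv BX; rewrite /row_full -mxrank_tr; apply: inj_row_free => w.
move/(congr1 trmx); rewrite trmx_mul trmxK trmx0 => Xk0.
set k := w^T in Xk0.
set W := rot3 rho b c in BX.
have Xk1 : frame u v *m (W *m k) = 0 by rewrite mulmxA -BX -mulmxA Xk0 mulmx0.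
have Xk2 : frame u v *m (W *m (W *m k)) = 0.
  by rewrite mulmxA -BX -mulmxA Xk1 mulmx0.
have E0 i : k o0 0 + u i 0 * k o1 0 + v i 0 * k o2 0 = 0.
  by have /matrixP/(_ i 0) := Xk0; rewrite mxE sum3 !mxE !triE mul1r.
have E1 i : rho * k o0 0 + u i 0 * (b * k o1 0 + c * k o2 0)
    + v i 0 * (b * k o2 0 - c * k o1 0) = 0.
  have /matrixP/(_ i 0) := Xk1; rewrite mxE sum3 !(mxE, sum3) !triE; lra.
have E2 i : rho * (rho * k o0 0)
    + u i 0 * (b * (b * k o1 0 + c * k o2 0) + c * (b * k o2 0 - c * k o1 0))
    + v i 0 * (b * (b * k o2 0 - c * k o1 0) - c * (b * k o1 0 + c * k o2 0)) = 0.
  have /matrixP/(_ i 0) := Xk2; rewrite mxE sum3 !(mxE, sum3) !triE; lra.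
have k0 : k o0 0 = 0.
  have h : k o0 0 * ((rho - b) ^+ 2 + c ^+ 2) = 0.
    have := E0 (Ordinal n0); have := E1 (Ordinal n0); have := E2 (Ordinal n0).
    move: (u _ _) (v _ _) (k _ _) (k o1 0) (k o2 0) => U V K0 K1 K2 e2 e1 e0.
    have -> : K0 * ((rho - b) ^+ 2 + c ^+ 2) =
     (rho * (rho * K0) + U * (b * (b * K1 + c * K2) + c * (b * K2 - c * K1))
    + V * (b * (b * K2 - c * K1) - c * (b * K1 + c * K2)))
     - 2 * b * (rho * K0 + U * (b * K1 + c * K2)
    + V * (b * K2 - c * K1)) + (b ^+ 2 + c ^+ 2) * (K0 + U * K1 + V * K2) by ring.
    by rewrite e0 e1 e2; ring.
  move/eqP: h; rewrite mulf_eq0 => /orP[/eqP //|].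
  by rewrite gt_eqF // ltr_wpDl ?sqr_ge0 // exprn_even_gt0.
have [E0' E1'] :
  (forall i, u i 0 * k o1 0 + v i 0 * k o2 0 = 0) /\
  (forall i, u i 0 * k o2 0 - v i 0 * k o1 0 = 0).
  split=> i; have := E0 i; have := E1 i; rewrite k0; first lra.
  move: (u i 0) (v i 0) => U V e1 e0; apply: (mulfI c0); rewrite mulr0.
  have -> : c * (U * k o2 0 - V * k o1 0) =
      rho * 0 + U * (b * k o1 0 + c * k o2 0) + V * (b * k o2 0 - c * k o1 0)
      - b * (0 + U * k o1 0 + V * k o2 0) by ring.
  by rewrite e1 e0; ring.
have [N0|N0] := eqVneq (k o1 0 ^+ 2 + k o2 0 ^+ 2) 0.
  have [k1 k2] : k o1 0 = 0 /\ k o2 0 = 0.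
    move/eqP: N0; rewrite paddr_eq0 ?sqr_ge0 // !sqrf_eq0.
    by move=> /andP[/eqP -> /eqP ->].
  apply: trmx_inj; rewrite trmx0 -/k; apply/matrixP=> i j; rewrite ord1 [RHS]mxE.
  by move: i; apply: ord3_ind.
exfalso; case/orP: uv => /eqP; apply; apply/matrixP=> i j; rewrite ord1 [RHS]mxE;
  apply: (mulIf N0); rewrite mul0r.
  have -> : u i 0 * (k o1 0 ^+ 2 + k o2 0 ^+ 2) =
    k o1 0 * (u i 0 * k o1 0 + v i 0 * k o2 0)
    + k o2 0 * (u i 0 * k o2 0 - v i 0 * k o1 0) by ring.
  by rewrite E0' E1'; ring.
have -> : v i 0 * (k o1 0 ^+ 2 + k o2 0 ^+ 2) =
    k o2 0 * (u i 0 * k o1 0 + v i 0 * k o2 0)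
    - k o1 0 * (u i 0 * k o2 0 - v i 0 * k o1 0) by ring.
by rewrite E0' E1'; ring.
Qed.

(** * Perturbation *)

(** The frame [1, u, v] is normalized by the inverse of its three
    rows that span the largest volume.  The result [Y] consists of barycentric
    coordinates, and the determinants of its rows are ratios of areas. *)
Lemma barycentric_frame (R : realType) (n : nat) (B : 'M[R]_n) (u v : 'cV[R]_n)
    (rho b c : R) :
  (0 < n)%N -> c != 0 -> (u != 0) || (v != 0) ->
  B *m frame u v = frame u v *m rot3 rho b c ->
  exists (Y : 'M[R]_(n, 3)) (f : 'I_3 -> 'I_n) (W : 'M[R]_3),
    [/\ rowsub f Y = 1%:M, Y *m const_mx 1 = const_mx 1 :> 'cV_n,
        forall g : 'I_3 -> 'I_n, \det (rowsub g Y) <= 1,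
        B *m Y = Y *m W &
        forall t, char_poly (W + t%:M) = char_poly (rot3 (rho + t) (b + t) c)].
Proof.
move=> n0 c0 uv BX; have Xfull := frame_full n0 c0 uv BX.
set X := frame u v in BX Xfull.
have [f f_unit fmax] := max_rowsub Xfull.
set M := rowsub f X in f_unit fmax.
exists (X *m invmx M), f, (M *m rot3 rho b c *m invmx M); split.
- by rewrite -mul_rowsub_mx mulmxV.
- pose e0 : 'cV[R]_3 := delta_mx o0 0.
  have Xe : X *m e0 = const_mx 1.
    by apply/matrixP=> i j; rewrite ord1 !mxE sum3 !mxE !triE /= mulr1 !mulr0 !addr0.
  have Me : M *m e0 = const_mx 1.
    by rewrite mul_rowsub_mx Xe; apply/matrixP=> i j; rewrite !mxE.
  by rewrite -Me -mulmxA mulKmx.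
- move=> g; rewrite -mul_rowsub_mx det_mulmx det_inv.
  have M0 : 0 < `|\det M| by rewrite normr_gt0 -unitfE -unitmxE.
  apply: le_trans (ler_norm _) _; rewrite normrM normfV ler_pdivrMr // mul1r.
  exact: fmax.
- by rewrite !mulmxA mulmxKV // BX.
- move=> t.
  have -> : rot3 (rho + t) (b + t) c = rot3 rho b c + t%:M.
    apply/matrixP; do 2!apply: ord3_ind; rewrite !mxE !triE /=; ring.
  apply: (@char_poly_intertwine _ _ _ _ M).
    by rewrite -unitfE -unitmxE.
  by rewrite mulmxDl mulmxKV // mulmxDr scalar_mxC.
Qed.

(** Rado's theorem, with the columns [f k] receiving [t] times the
    barycentric coordinates, moves three eigenvalues by [t] while keeping the
    row sums constant; the resulting matrix may have negative entries.
    Adding suitable constants to these columns restores nonnegativity and, by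
    Brauer's theorem, only moves the eigenvalue [rho + t]. *)
Lemma real_perturbation (R : realType) (n : nat) (B : 'M[R]_n) (u v : 'cV[R]_n)
    (rho b c t t' : R) :
  (3 <= n)%N -> (forall i j, 0 <= B i j) -> (forall i, \sum_j B i j = rho) ->
  c != 0 -> (u != 0) || (v != 0) ->
  (forall i, (B *m u) i 0 = b * u i 0 - c * v i 0) ->
  (forall i, (B *m v) i 0 = c * u i 0 + b * v i 0) ->
  0 <= t -> gamma R n * t <= t' ->
  exists B' : 'M[R]_n, (forall i j, 0 <= B' i j) /\
    char_poly B' * (('X - (rho + t)%:P) * char_poly (rot3 rho b c)) =
    char_poly B * (char_poly (rot3 (rho + t) (b + t) c) * ('X - (rho + t')%:P)).
Proof.
move=> n3 B_ge0 Bs c0 uv Bu Bv t0 tt'.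
have n0 : (0 < n)%N by apply: leq_trans n3.
have [Y [f [W [Yf Y1 Ydet BY Wt]]]] :=
  barycentric_frame n0 c0 uv (mulmx_frame Bs Bu Bv).
have Ysum i : \sum_k Y i k = 1.
  have /matrixP/(_ i 0) := Y1; rewrite !mxE => e; rewrite -[RHS]e.
  by apply: eq_bigr => k _; rewrite mxE mulr1.
have Yfl l k : Y (f l) k = (l == k)%:R by have /matrixP/(_ l k) := Yf; rewrite !mxE.
have pP k : exists i, forall j, Y i k <= Y j k.
  have [i _ imin] := @arg_minP _ _ _ (Ordinal n0) xpredT (fun j => Y j k) isT.
  by exists i => j; apply: imin.
have [p pmin] := choice pP.
have Yp k : Y (p k) k <= 0.
  by apply: le_trans (pmin k (f (if k == o0 then o1 else o0))) _; rewrite Yfl;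
     move: k {Yfl}; apply: ord3_ind.
have ratio := triangle_ratio Yf Ysum Ydet Yp.
set s := \sum_k Y (p k) k in ratio.
have slack : 0 <= t' - (1 - s) * t.
  by have := ler_wpM2r t0 ratio; lra.
pose E : 'M[R]_(3, n) := \matrix_(k, j) (j == f k)%:R.
pose B1 := B + Y *m (t *: E).
have EY : E *m Y = 1%:M.
  rewrite -Yf; apply/matrixP=> k l; rewrite !mxE (bigD1 (f k)) //= mxE eqxx mul1r.
  by rewrite big1 ?addr0 // => j /negPf jf; rewrite mxE jf mul0r.
have E1 : E *m const_mx 1 = const_mx 1 :> 'cV_3.
  apply/matrixP=> k l; rewrite !mxE (bigD1 (f k)) //= !mxE eqxx mul1r.
  by rewrite big1 ?addr0 // => j /negPf jf; rewrite mxE jf mul0r.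
have cpB1 : char_poly B1 * char_poly (rot3 rho b c) =
            char_poly B * char_poly (rot3 (rho + t) (b + t) c).
  have := char_poly_rado (t *: E) BY.
  rewrite -scalemxAl EY scalemx1 Wt; move: (Wt 0); rewrite !addr0.
  by rewrite (_ : 0%:M = 0) ?addr0 => [->|]; rewrite ?raddf0.
have B1s i : \sum_j B1 i j = rho + t.
  have : (B1 *m const_mx 1 : 'cV_n) i 0 = rho + t.
    rewrite mulmxDl -mulmxA -scalemxAl E1 -scalemxAr Y1 !mxE mulr1 -(Bs i).
    by congr (_ + _); apply: eq_bigr => j _; rewrite mxE mulr1.
  by rewrite mxE => <-; apply: eq_bigr => j _; rewrite [X in _ * X]mxE mulr1.
(* t x_l makes column f l nonnegative; the surplus goes to column f 0 *)
pose w l := - t * Y (p l) l + (if l == o0 then t' - (1 - s) * t else 0).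
pose k : 'rV[R]_n := \row_j \sum_l w l * (j == f l)%:R.
have ks : \sum_j k 0 j = t' - t.
  transitivity (\sum_l w l).
    rewrite (eq_bigr (fun j => \sum_l w l * (j == f l)%:R)); last first.
      by move=> j _; rewrite mxE.
    rewrite exchange_big; apply: eq_bigr => l _.
    rewrite (bigD1 (f l)) //= eqxx mulr1 big1 ?addr0 // => j /negPf ->.
    by rewrite mulr0.
  rewrite sum3 /w /= /s sum3; ring.
exists (B1 + const_mx 1 *m k); split.
  move=> i j; rewrite !mxE big_ord1 !mxE mul1r -addrA addr_ge0 // -big_split.
  rewrite sumr_ge0 // => l _ /=; rewrite !mxE mulrA -mulrDl mulr_ge0 //.
  rewrite /w addrA addr_ge0 //; last by case: ifP.
  rewrite mulNr mulrC -mulrBr mulr_ge0 // subr_ge0.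
  exact: pmin.
have := char_poly_rank1 k B1s; rewrite ks.
have -> : rho + t + (t' - t) = rho + t' by ring.
by move=> e; rewrite [LHS]mulrA e mulrAC cpB1 mulrA.
Qed.

Lemma map_char_poly_complexify (R : realType) (n : nat) (A : 'M[R]_n) :
  char_poly (complexify A) = map_poly (real_complex R) (char_poly A).
Proof. by rewrite /complexify map_char_poly. Qed.

(** The list of eigenvalues bounds the set of their moduli, so the
    supremum in the definition of the spectral radius is a genuine one. *)
Lemma root_le_spectral_radius (R : realType) (n : nat) (A : 'M[R]_n)
    (s : seq R[i]) (r : R) :
  has_eigenvalues A s -> root (char_poly A) r -> r <= spectral_radius A.
Proof.
move=> As rt; apply: (@le_trans _ _ (complex.Re `|r%:C|)).
  by rewrite normc_def /= expr0n addr0 sqrtr_sqr ler_norm.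
apply: ub_le_sup; last first.
  exists r%:C => //=; rewrite eigenvalue_root_char map_char_poly_complexify.
  by rewrite (fmorph_root (real_complex R)).
exists (\sum_(z <- s) complex.Re `|z|) => _ [z /= Hz <-].
have Re_ge0 (y : R[i]) : 0 <= complex.Re `|y| by rewrite normc_def sqrtr_ge0.
move: Hz; rewrite eigenvalue_root_char As root_prod_XsubC => zs.
by rewrite (big_rem z) //= lerDl sumr_ge0 // => y _; exact: Re_ge0.
Qed.

Lemma map_char_poly_rot3 (R : realType) (r b c : R) :
  map_poly (real_complex R) (char_poly (rot3 r b c)) =
  ('X - r%:C%:P) * (('X - (b +i* c)%:P) * ('X - (b -i* c)%:P)).
Proof.
rewrite char_poly_rot3 !(rmorphM, rmorphB, rmorphXn, rmorphD) /=.
rewrite !map_polyX !map_polyC /=; congr (_ * _).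
have -> : b +i* c = b%:C + 'i * c%:C by rewrite [LHS]complexE.
have -> : b -i* c = b%:C - 'i * c%:C by rewrite [LHS]complexE /= rmorphN mulrN.
have i2 : ('i : R[i])%:P * 'i%:P = -1 by rewrite -polyCM -expr2 sqr_i polyCN.
rewrite polyCD polyCB polyCM.
move: ('i%:P) i2 => I i2.
have -> : ('X - (b%:C%:P + I * c%:C%:P)) * ('X - (b%:C%:P - I * c%:C%:P))
  = ('X - b%:C%:P) ^+ 2 - (I * I) * c%:C%:P ^+ 2 by ring.
by rewrite i2; ring.
Qed.

Theorem theorem1p1 (R : realType) (n : nat) (hn : (3 <= n)%N)
    (A : 'M[R]_n) (rho b c : R) (lambda2 lambda3 : R[i])
    (lambda : (n - 3).-tuple R[i])
    (hA : nonnegative_mx A)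
    (hspec : has_eigenvalues A [:: rho%:C, lambda2, lambda3 & lambda])
    (hrho : rho = perron_eigenvalue A)
    (hlambda2 : lambda2 = b +i* c) (hlambda3 : lambda3 = b -i* c)
    (hc : c != 0)
    (t : R) (ht : 0 <= t) (t' : R) (ht' : gamma R n * t <= t') :
  exists B : 'M[R]_n,
    nonnegative_mx B /\
    has_eigenvalues B
      [:: (rho + t')%:C, lambda2 + t%:C, lambda3 + t%:C & lambda].
Proof.
subst lambda2 lambda3.
have rho_root : root (char_poly A) rho.
  rewrite -(fmorph_root (real_complex R)) -map_char_poly_complexify hspec.
  by rewrite root_prod_XsubC mem_head.
have rho_max r : root (char_poly A) r -> r <= rho.
  by rewrite hrho; apply: root_le_spectral_radius hspec.
have [B [B_ge0 cpB _ /(_ rho_root) Bs]] := row_sum_realization hA rho_max.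
have [u [v [uv Bu Bv]]] : exists u v : 'cV[R]_n,
    [/\ (u != 0) || (v != 0),
        forall i, (B *m u) i 0 = b * u i 0 - c * v i 0 &
        forall i, (B *m v) i 0 = c * u i 0 + b * v i 0].
  apply: real_eigenpair; rewrite -/(complexify B) map_char_poly_complexify cpB.
  rewrite -map_char_poly_complexify hspec root_prod_XsubC.
  by rewrite in_cons mem_head orbT.
have [B' [B'_ge0 cpB']] := real_perturbation hn B_ge0 Bs hc uv Bu Bv ht ht'.
exists B'; split; first exact: B'_ge0.
rewrite /has_eigenvalues map_char_poly_complexify.
move/(congr1 (map_poly (real_complex R))): cpB'.
rewrite !rmorphM /= !map_char_poly_rot3 !rmorphB /= !map_polyX !map_polyC /=.
rewrite cpB -(map_char_poly_complexify A) hspec !big_cons.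
have -> : (b +i* c) + t%:C = (b + t) +i* c.
  by apply/eqP; rewrite eq_complex /= addr0 !eqxx.
have -> : (b -i* c) + t%:C = (b + t) -i* c.
  by apply/eqP; rewrite eq_complex /= addr0 !eqxx.
set Q := \prod_(z <- lambda) _.
set p := map_poly _ _.
set x1 := 'X - _; set x2 := 'X - _; set x3 := 'X - _; set x4 := 'X - _.
set x5 := 'X - _; set x6 := 'X - _; set x7 := 'X - _.
move=> e.
have e' : (x1 * x2 * x3 * x4) * p = (x1 * x2 * x3 * x4) * (x7 * (x5 * (x6 * Q))).
  by transitivity (p * (x4 * (x1 * (x2 * x3)))); [ring | rewrite e; ring].
by apply: mulfI e'; rewrite !mulf_neq0 // polyXsubC_eq0.
Qed.
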